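(* Let $0\le d\le k-1$ and $m=k-d-1$. Then $$\mathfrak M_{[2k,2d+1]}(x)=\frac{\bigl(1-x^2(R_m(x^2)+R_d(x^2))+x(1-x^2R_m(x^2)R_d(x^2))\bigr)\bigl(1+x^2R_m(x^2)R_d(x^2)\bigr)}{1-x^2\bigl(1+x^2R_m^2(x^2)\bigr)\bigl(1+x^2R_d^2(x^2)\bigr)}.$$
   Context: $\mathfrak S_n$ is the set of permutations of $\{1,\dots,n\}$ (for $n=0$, the empty permutation, which is even). A permutation avoids a pattern $\tau$ of length $\ell$ if none of its length-$\ell$ subsequences is order-isomorphic to $\tau$. For $1\le d\le k$, $[k,d]$ denotes the pattern $(d+1)(d+2)\ldots k\,1\,2\ldots d\in\mathfrak S_k$. $\mathfrak M_\tau(x)=\mathfrak E_\tau(x)-\mathfrak O_\tau(x)$, where $\mathfrak E_\tau(x)$ (resp. $\mathfrak O_\tau(x)$) is the ordinary generating function in $n$ for the number of even (resp. odd) permutations in $\mathfrak S_n$, $n\ge0$, avoiding both $132$ and $\tau$. $U_r$ is the Chebyshev polynomial of the second kind: $U_0(t)=1$, $U_1(t)=2t$, $U_r(t)=2tU_{r-1}(t)-U_{r-2}(t)$. For $k\ge1$, $R_k(x)=\dfrac{U_{k-1}\left(\frac1{2\sqrt x}\right)}{\sqrt x\,U_k\left(\frac1{2\sqrt x}\right)}$, a rational function of $x$, and $R_0(x)=0$; equivalently $R_k(x)=1/(1-xR_{k-1}(x))$ for $k\ge1$. $R_k^2(x^2)$ means $(R_k(x^2))^2$. *)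

(* Defs.v *)
From HB Require Import structures.
From mathcomp Require Import all_boot all_order all_fingroup all_algebra.

Set Implicit Arguments.
Unset Strict Implicit.
Unset Printing Implicit Defensive.

Import GRing.Theory.

(* A permutation of {1, ..., n} is an element of 'S_n = {perm 'I_n}, positions
   and values being shifted down by one. A pattern is given by its one-line
   notation; only the relative order of its letters matters. *)

Definition contains (p : seq nat) (n : nat) (s : 'S_n) : bool :=
  [exists f : {ffun 'I_(size p) -> 'I_n},
    [forall a : 'I_(size p), forall b : 'I_(size p), (a < b) ==> (f a < f b)] &&
    [forall a : 'I_(size p), forall b : 'I_(size p),
       (s (f a) < s (f b)) == (nth 0 p a < nth 0 p b)]].

Definition avoids (p : seq nat) (n : nat) (s : 'S_n) : bool := ~~ contains p s.

Definition pattern132 : seq nat := [:: 1; 3; 2].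

(* The pattern [k, d] = (d+1) (d+2) ... k 1 2 ... d, for 1 <= d <= k. *)
Definition block_pattern (k d : nat) : seq nat := iota d.+1 (k - d) ++ iota 1 d.

Definition even_count (tau : seq nat) (n : nat) : nat :=
  #|[set s : 'S_n | [&& ~~ odd_perm s, avoids pattern132 s & avoids tau s]]|.

Definition odd_count (tau : seq nat) (n : nat) : nat :=
  #|[set s : 'S_n | [&& odd_perm s, avoids pattern132 s & avoids tau s]]|.

Local Open Scope ring_scope.

Definition M_coef (tau : seq nat) (n : nat) : rat :=
  (even_count tau n)%:R - (odd_count tau n)%:R.

Notation "x %:F" := (tofrac x) : ring_scope.

(* The formal power series \sum_n a_n x^n is the expansion at 0 of the rational
   function r: r = p / q for polynomials p, q with q(0) <> 0 such that
   q * (\sum_n a_n x^n) = p as formal power series. *)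
Definition is_expansion (a : nat -> rat) (r : {fraction {poly rat}}) : Prop :=
  exists p q : {poly rat},
    [/\ q`_0 != 0, r = p%:F / q%:F
      & forall n : nat, \sum_(i < n.+1) q`_i * a (n - i)%N = p`_n].

Fixpoint chebU (A : nzRingType) (r : nat) : {poly A} :=
  match r with
  | 0 => 1
  | r1.+1 =>
    match r1 with
    | 0 => 2%:R *: 'X
    | r2.+1 => 2%:R *: 'X * chebU A r1 - chebU A r2
    end
  end.

(* R_sq k t is R_k(t^2), i.e. R_k(x) with t in the role of sqrt x. The choice
   of the square root is immaterial because U_k has the parity of k. *)
Definition R_sq (K : fieldType) (k : nat) (t : K) : K :=
  if k is k1.+1
  then (chebU K k1).[(2%:R * t)^-1] / (t * (chebU K k).[(2%:R * t)^-1])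
  else 0.

(* Main.v *)
Require Import Defs.
From HB Require Import structures.
From mathcomp Require Import all_boot all_order all_fingroup all_algebra.
From mathcomp Require Import zify ring.

(** A nonempty 132-avoiding word is L M R, where M is its maximum, L and R
    avoid 132 and every letter of L exceeds every letter of R; so 132-avoiding
    permutations are binary trees (tree_word_surj, tree_word_inj,
    sum_avoids132). The inversions between the three parts number
    |R| + |L| |R|, hence the sign of L M R is the product of the signs of L and
    R, reversed exactly when |L| is even and |R| is odd. It therefore pays to
    split each signed generating function F into its part F_e over even sizes
    and its part F_o over odd sizes: if L ranges over a family A and R over a
    family B, the words L M R contribute x (A_o B_e - A_e B_o) to the even part
    and x (A_e B_e + A_o B_o) to the odd part (signed_gf_node). Writing
    F = F_e + i F_o, this is the single product i x conj(A) B.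

    Let F_k count the words without increasing subsequence of length k. Such an
    L M R has L counted by F_(k-1) and R by F_k, so
    F_k = 1 / (1 - i x conj(F_(k-1))). Two steps of this recurrence form the
    homography Z |-> (1 + i x Z) / (1 - i x + i x Z), which has determinant x^2
    and trace 1 like R |-> 1 / (1 - x^2 R); the substitution
    Z = R / (1 - i x R) conjugates the two. Hence
    F_(2m) = R_m / (1 - i x R_m) and F_(2d+1) = 1 + i x R_d, where R_k stands
    for R_k(x^2) (signed_gf_lis_even, signed_gf_lis_odd).

    The pattern [2k, 2d+1] is an increasing run of 2m+1 letters followed by an
    increasing run of 2d+1 smaller letters. It occurs in L M R exactly when it
    occurs in L, or in R, or when L has an increasing subsequence of length 2m
    (which M prolongs) and R has one of length 2d+1 (two_blocks_tree_word). By
    inclusion and exclusion (avoid_weightE) the generating function Z of the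
    avoiders satisfies
      Z = 1 + i x (conj(F_(2m)) Z + conj(Z) F_(2d+1) - conj(F_(2m)) F_(2d+1)),
    a linear system in Z_e and Z_o, solved by Cramer's rule (solve_avoid).

    Power series are handled through polynomials: the trees of height at most
    h include all those of size at most h, so the equations hold modulo
    X^(h+1), with denominators cleared by means of polynomials Q_k, P_k such
    that R_k(x^2) = Q_k / P_k and P_k(0) = 1. *)

Set Implicit Arguments.
Unset Strict Implicit.
Unset Printing Implicit Defensive.

(** * One-line notation, parity and pattern containment *)

Definition word (n : nat) (s : 'S_n) : seq nat := [seq val (s i) | i <- enum 'I_n].

Fixpoint inversions (w : seq nat) : nat :=
  if w is x :: w' then count (ltn^~ x) w' + inversions w' else 0.

Lemma size_word n (s : 'S_n) : size (word s) = n.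
Proof. by rewrite size_map size_enum_ord. Qed.

Lemma nth_word n (s : 'S_n) (i : 'I_n) : nth 0 (word s) i = s i.
Proof. by rewrite (nth_map i) ?size_enum_ord ?ltn_ord // nth_ord_enum. Qed.

Lemma word_inj n : injective (@word n).
Proof.
by move=> s t eq_st; apply/permP => i; apply: val_inj; rewrite /= -!nth_word eq_st.
Qed.

Lemma perm_word n (s : 'S_n) : perm_eq (word s) (iota 0 n).
Proof.
apply: uniq_perm; rewrite ?iota_uniq //.
  by rewrite map_inj_uniq ?enum_uniq // => i j /val_inj /perm_inj.
move=> x; rewrite mem_iota add0n /=; apply/mapP/idP => [[i _ ->]|lt_xn].
  exact: ltn_ord.
by exists ((s^-1)%g (Ordinal lt_xn)); rewrite ?mem_enum // permKV.
Qed.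

Lemma inversions_map f w :
  {mono f : x y / x < y} -> inversions (map f w) = inversions w.
Proof.
move=> f_mono; elim: w => //= x w ->; rewrite count_map; congr (_ + _).
by apply: eq_count => y /=; rewrite f_mono.
Qed.

Lemma bump_mono j : {mono bump j : x y / x < y}.
Proof. by move=> x y; rewrite /bump; lia. Qed.

Lemma word_lift_perm n (j : 'I_n.+1) (s : 'S_n) :
  word (lift_perm ord0 j s) = val j :: map (bump j) (word s).
Proof.
rewrite /word enum_ordSl /= lift_perm_id -!map_comp; congr (_ :: _).
by apply: eq_map => i /=; rewrite lift_perm_lift.
Qed.

(** The permutation is built from its first letter j, and both claims are proved
    together: lift_perm inserts j with parity that of j, and j is also the
    number of letters below the first one. Since one-line notation is injective,
    this gives the parity of every permutation. *)
Lemma exists_word n w : perm_eq w (iota 0 n) ->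
  exists s : 'S_n, word s = w /\ odd_perm s = odd (inversions w).
Proof.
elim: n w => [|n IHn] w eq_w.
  exists 1%g; rewrite odd_perm1 (perm_nilP eq_w) //; split=> //.
  by apply: size0nil; rewrite size_word.
case: w eq_w => [/perm_size //|j w] eq_w.
have /= /andP[j_w uniq_w] : uniq (j :: w) by rewrite (perm_uniq eq_w) iota_uniq.
have lt_j : j < n.+1 by rewrite -[_ < _](mem_iota 0) -(perm_mem eq_w) mem_head.
have [v def_w] : exists v, w = map (bump j) v.
  exists (map (unbump j) w); rewrite -map_comp map_id_in // => x x_w /=.
  by rewrite unbumpK // inE; apply: contraNneq j_w => <-.
have eq_v : perm_eq v (iota 0 n).
  apply: uniq_perm; rewrite ?iota_uniq //.
    by move: uniq_w; rewrite def_w => /map_uniq.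
  move=> x; rewrite mem_iota add0n /=.
  have := perm_mem eq_w (bump j x).
  rewrite mem_iota inE eq_sym (negPf (neq_bump _ _)) /= def_w mem_map; last first.
    exact: can_inj (bumpK j).
  by move=> ->; rewrite /bump; lia.
have [s [word_s odd_s]] := IHn v eq_v.
exists (lift_perm ord0 (Ordinal lt_j) s); split.
  by rewrite word_lift_perm word_s -def_w.
rewrite odd_lift_perm /= odd_s oddD def_w inversions_map; last exact: bump_mono.
congr (odd _ (+) _); rewrite count_map.
rewrite (eq_count (a2 := ltn^~ j)); last by move=> x /=; rewrite /bump; lia.
rewrite (seq.permP eq_v) -size_filter.
rewrite (_ : filter _ _ = iota 0 j) ?size_iota //.
apply: (irr_sorted_eq ltn_trans ltnn).
- exact: (sorted_filter ltn_trans) (iota_ltn_sorted _ _).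
- exact: iota_ltn_sorted.
- by move=> x; rewrite mem_filter !mem_iota /=; lia.
Qed.

Lemma odd_word n (s : 'S_n) : odd_perm s = odd (inversions (word s)).
Proof.
by have [t [/word_inj-> ->]] := exists_word (perm_word s).
Qed.

(** Pattern containment in a word, phrased with subsequences rather than with
    positions so that it can be followed through concatenations. *)
Definition occurs (p w : seq nat) : Prop :=
  exists u, [/\ subseq u w, size u = size p &
    forall i j, i < size p -> j < size p ->
      (nth 0 u i < nth 0 u j) = (nth 0 p i < nth 0 p j)].

Lemma enum_ord_sorted n : sorted ltn (map val (enum 'I_n)).
Proof. by rewrite val_enum_ord iota_ltn_sorted. Qed.

(** Increasing position functions correspond to subsequences: the list of the
    chosen positions is sorted, hence a subsequence of the list of all of them. *)
Lemma containsP p n (s : 'S_n) : reflect (occurs p (word s)) (contains p s).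
Proof.
apply: (iffP existsP) => [[f /andP[/forallP f_mono /forallP f_iso]]|[u [sub_u]]].
  exists [seq val (s (f a)) | a <- enum 'I_(size p)]; split.
  - rewrite (map_comp (fun i => val (s i)) f); apply: map_subseq.
    apply/(subseq_uniqP (enum_uniq _)).
    have lt_trans : transitive (relpre (@nat_of_ord n) ltn).
      by move=> x y z; apply: ltn_trans.
    apply: (irr_sorted_eq lt_trans) => [x|||x]; first exact: ltnn.
    + have := enum_ord_sorted (size p); rewrite !sorted_map.
      by apply: sub_sorted => a b; move/implyP: (forallP (f_mono a) b).
    + by apply: (sorted_filter lt_trans); rewrite -sorted_map enum_ord_sorted.
    + by rewrite mem_filter mem_enum andbT.
  - by rewrite size_map size_enum_ord.
  - move=> i j lt_i lt_j.
    have nthE k (lt_k : k < size p) :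
        nth 0 [seq val (s (f a)) | a <- enum 'I_(size p)] k = s (f (Ordinal lt_k)).
      rewrite (nth_map (Ordinal lt_k)) ?size_enum_ord //.
      by congr (val (s (f _))); apply: val_inj; rewrite /= nth_enum_ord.
    rewrite !nthE.
    by have /eqP := forallP (f_iso (Ordinal lt_i)) (Ordinal lt_j).
have /subseqP[msk size_msk def_u] := sub_u.
move=> size_u u_iso.
pose v := mask msk (enum 'I_n).
have {def_u} def_u : u = map (fun i => val (s i)) v by rewrite def_u map_mask.
have size_v : size v = size p by rewrite -size_u def_u size_map.
have sorted_v : sorted ltn (map val v).
  rewrite map_mask; apply: (subseq_sorted ltn_trans) (enum_ord_sorted n).
  exact: mask_subseq.
have tup_v : size v == size p by apply/eqP.
exists [ffun a => tnth (Tuple tup_v) a].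
have fE a i0 : tnth (Tuple tup_v) a = nth i0 v a by rewrite (tnth_nth i0).
apply/andP; split; apply/forallP => a; apply/forallP => b; rewrite !ffunE;
  have i0 := tnth (Tuple tup_v) a.
  apply/implyP => lt_ab; rewrite !(fE _ i0).
  have := sorted_ltn_nth ltn_trans 0 sorted_v.
  move=> /(_ a b); rewrite !inE size_map size_v !ltn_ord => /(_ isT isT lt_ab).
  by rewrite !(nth_map i0) ?size_v ?ltn_ord.
apply/eqP; rewrite -u_iso ?ltn_ord // def_u !(fE _ i0).
by rewrite !(nth_map i0) ?size_v ?ltn_ord.
Qed.

(** * Splitting words *)

Lemma subseq_catP (T : eqType) (u v w : seq T) :
  subseq u (v ++ w) ->
  exists u1 u2, [/\ u = u1 ++ u2, subseq u1 v & subseq u2 w].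
Proof.
elim: v u => [|x v IHv] u /=; first by exists [::], u.
case: u => [_|y u]; first by exists [::], [::]; rewrite !sub0seq.
case: ifP => [/eqP-> /IHv[u1 [u2 [-> sub1 sub2]]]|ne_yx].
  by exists (x :: u1), u2; rewrite /= eqxx.
move=> /IHv[u1 [u2 [def_u sub1 sub2]]]; exists u1, u2; split=> //.
exact: subseq_trans sub1 (subseq_cons _ _).
Qed.

Lemma eq_catP (T : Type) (u v a b : seq T) : u ++ v = a ++ b ->
  (exists c, a = u ++ c /\ v = c ++ b) \/ (exists c, u = a ++ c /\ b = c ++ v).
Proof.
elim: u a => [|x u IHu] [|y a] /=.
- by move=> ->; left; exists [::].
- by move=> ->; left; exists (y :: a).
- by move=> <-; right; exists (x :: u).
by case=> -> /IHu[[c [-> ->]]|[c [-> ->]]]; [left|right]; exists c.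
Qed.

(** * Binary trees and 132-avoiding words *)

Inductive tree := Leaf | Node of tree & tree.

Fixpoint eq_tree (t u : tree) : bool :=
  match t, u with
  | Leaf, Leaf => true
  | Node l r, Node l' r' => eq_tree l l' && eq_tree r r'
  | _, _ => false
  end.

Lemma eq_treeP : Equality.axiom eq_tree.
Proof.
elim=> [|l IHl r IHr] [|l' r'] /=; try by constructor.
by apply: (iffP andP) => [[/IHl-> /IHr->]|[/IHl-> /IHr->]].
Qed.

HB.instance Definition _ := hasDecEq.Build tree eq_treeP.

Fixpoint nodes (t : tree) : nat :=
  if t is Node l r then (nodes l + nodes r).+1 else 0.

(** The letters of [tree_word o t] are o, ..., o + nodes t - 1; the offset o lets
    the left subtree sit above the right one without renaming letters. *)
Fixpoint tree_word (o : nat) (t : tree) : seq nat :=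
  if t is Node l r
  then tree_word (o + nodes r) l ++ o + nodes l + nodes r :: tree_word o r
  else [::].

(** Parity of the number of inversions; the last term is |R| + |L| |R| mod 2. *)
Fixpoint tree_odd (t : tree) : bool :=
  if t is Node l r
  then tree_odd l (+) tree_odd r (+) (~~ odd (nodes l) && odd (nodes r))
  else false.

Fixpoint lis (t : tree) : nat :=
  if t is Node l r then maxn (lis l).+1 (lis r) else 0.

(** In an occurrence that straddles the parts of L M R, the run of p letters lies
    in L M, where M prolongs any run of L, and the run of q smaller letters lies
    in R. *)
Fixpoint has_block (p q : nat) (t : tree) : bool :=
  if t is Node l r
  then [|| has_block p q l, has_block p q r | (p <= (lis l).+1) && (q <= lis r)]
  else false.

Lemma size_tree_word o t : size (tree_word o t) = nodes t.
Proof. by elim: t o => //= l IHl r IHr o; rewrite size_cat /= IHl IHr addnS. Qed.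

Lemma perm_tree_word o t : perm_eq (tree_word o t) (iota o (nodes t)).
Proof.
elim: t o => [|l IHl r IHr] o //.
have -> : nodes (Node l r) = nodes r + nodes l + 1 by rewrite /=; lia.
rewrite !iotaD [tree_word _ _]/=.
apply/seq.permP => P.
have /seq.permP/(_ P) count_l := IHl (o + nodes r).
have /seq.permP/(_ P) count_r := IHr o.
rewrite !count_cat /= count_l count_r.
rewrite (_ : o + nodes l + _ = o + (nodes r + nodes l)); last lia.
by move: (nat_of_bool _) (count _ _) (count _ _) => b c1 c2; lia.
Qed.

Lemma mem_tree_word o t x : (x \in tree_word o t) = (o <= x < o + nodes t).
Proof. by rewrite (perm_mem (perm_tree_word o t)) mem_iota. Qed.

Lemma tree_word_inj o : injective (tree_word o).
Proof.
move=> t; elim: t o => [|l IHl r IHr] o [|l' r'] //= eq_w.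
- by move/(congr1 size): eq_w; rewrite size_cat /= addnS.
- by move/(congr1 size): eq_w; rewrite size_cat /= addnS.
have := congr1 size eq_w; rewrite !size_cat /= !size_tree_word => eq_size.
set M := o + nodes l + nodes r.
have eq_M : o + nodes l' + nodes r' = M by rewrite /M; lia.
rewrite eq_M -/M in eq_w.
(* The maximum M occurs only at the root, so its index is the size of the left
   subtree. *)
have indexM (u : tree) o' v : o' + nodes u <= M ->
    index M (tree_word o' u ++ M :: v) = nodes u.
  move=> le_M; rewrite index_cat mem_tree_word [M < _]ltnNge le_M andbF.
  by rewrite size_tree_word /= eqxx addn0.
have eq_l : nodes l = nodes l'.
  by have := congr1 (index M) eq_w; rewrite !indexM //; lia.
have eq_r : nodes r = nodes r' by lia.
move/eqP: eq_w; rewrite eqseq_cat ?size_tree_word // eqseq_cons eqxx /= eq_r.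
by case/andP=> /eqP/IHl-> /eqP/IHr->.
Qed.

Lemma inversions_cat c u v : {in u, forall x, count (ltn^~ x) v = c} ->
  inversions (u ++ v) = inversions u + inversions v + size u * c.
Proof.
elim: u => [|x u IHu] count_v /=; first lia.
rewrite IHu; last by move=> y y_u; rewrite count_v // inE y_u orbT.
rewrite count_cat count_v ?mem_head // mulSn.
by move: (count _ u) (inversions u) (inversions v) (_ * _) => n1 n2 n3 n4; lia.
Qed.

Lemma odd_inversions_tree_word o t : odd (inversions (tree_word o t)) = tree_odd t.
Proof.
elim: t o => //= l IHl r IHr o.
have count_r M : o + nodes r <= M -> count (ltn^~ M) (tree_word o r) = nodes r.
  move=> le_M; rewrite -(size_tree_word o); apply/eqP; rewrite -all_count.
  by apply/allP => x; rewrite mem_tree_word /=; lia.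
rewrite (@inversions_cat (nodes r)) => [|x]; last first.
  by rewrite mem_tree_word /= => x_l; rewrite count_r; lia.
rewrite /= count_r; last lia.
rewrite !oddD !oddM size_tree_word IHl IHr.
by case: odd; case: odd; case: tree_odd; case: tree_odd.
Qed.

Definition has132 (w : seq nat) : Prop :=
  exists x y z, subseq [:: x; y; z] w /\ x < z < y.

Lemma occurs132P w : occurs pattern132 w <-> has132 w.
Proof.
split=> [[u [sub_u size_u u_iso]]|[x [y [z [sub_u lt_xzy]]]]].
  move: u size_u => [|x [|y [|z []]]] //= _ in sub_u u_iso *.
  exists x, y, z; split=> //.
  by have /= -> := u_iso 0 2 isT isT; have /= -> := u_iso 2 1 isT isT.
exists [:: x; y; z]; split=> // [] [|[|[|i]]] [|[|[|j]]] //= _ _; lia.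
Qed.

Lemma has132_sub v w : subseq v w -> has132 v -> has132 w.
Proof.
move=> sub_vw [x [y [z [sub_v lt_xzy]]]]; exists x, y, z; split=> //.
exact: subseq_trans sub_v sub_vw.
Qed.

(** Let x y z be an occurrence of 132 in L M R, so that x < z < y. If x is in L,
    then y and z, being larger, are not in R, and z is not M because y > z; so
    all three are in L. And x is not M because y > x; so otherwise all three are
    in R. *)
Lemma tree_word_avoids132 o t : ~ has132 (tree_word o t).
Proof.
elim: t o => [|l IHl r IHr] o /= [x [y [z []]]] //.
move=> /subseq_catP[u1 [u2 [def_u sub1 sub2]]] lt_xzy.
have mem1 a : a \in u1 -> o + nodes r <= a < o + nodes r + nodes l.
  by move=> /(mem_subseq sub1); rewrite mem_tree_word.
have mem2 a : a \in u2 -> o <= a < o + nodes r \/ a = o + nodes l + nodes r.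
  move=> /(mem_subseq sub2); rewrite inE mem_tree_word.
  by case/orP=> [/eqP->|]; [right|left].
move: u1 def_u sub1 mem1 => [|x' [|y' [|z' [|? ?]]]] //=.
- move=> def_u _ _; subst u2.
  have y_le : y <= o + nodes l + nodes r.
    by have := mem2 y; rewrite !inE eqxx orbT => /(_ isT); lia.
  move: sub2; rewrite [subseq _ _]/=; case: eqP => [eq_x|_ sub_r]; first lia.
  by apply: (IHr o); exists x, y, z.
- move=> [<- def_u] _ mem1; subst u2.
  have := mem1 x; have := mem2 y; have := mem2 z.
  by rewrite !inE !eqxx orbT => /(_ isT) + /(_ isT) + /(_ isT); lia.
- move=> [<- <- def_u] _ mem1; subst u2.
  have := mem1 x; have := mem1 y; have := mem2 z.
  by rewrite !inE !eqxx orbT => /(_ isT) + /(_ isT) + /(_ isT); lia.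
- by move=> [<- <- <-] _ sub _; apply: (IHl (o + nodes r)); exists x, y, z.
Qed.

(** A letter of L below a letter of R would form 132 with the maximum between
    them. So all letters of R are below those of L, and sorting the two parts
    separately yields the interval of all letters: each part is an interval. *)
Lemma tree_word_surj o n w : perm_eq w (iota o n) -> ~ has132 w ->
  exists2 t, nodes t = n & tree_word o t = w.
Proof.
have [N] := ubnP n; elim: N o n w => // N IHN o [|n] w lt_nN eq_w no132.
  by exists Leaf; rewrite // (perm_nilP eq_w).
have mem_w x : x \in w = (o <= x < o + n.+1) by rewrite (perm_mem eq_w) mem_iota.
have uniq_w : uniq w by rewrite (perm_uniq eq_w) iota_uniq.
have M_w : o + n \in w by rewrite mem_w; lia.
move: eq_w no132 mem_w uniq_w.
case/path.splitPr: w / M_w => u v eq_w no132 mem_w uniq_w.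
have gt_uv x y : x \in u -> y \in v -> y < x.
  move=> x_u y_v; rewrite ltnNge; apply/negP => le_xy; apply: no132.
  have lt_y : y < o + n.
    have := mem_w y; rewrite mem_cat inE y_v !orbT => /esym.
    have: y != o + n.
      apply: contraTneq uniq_w => <-.
      by rewrite cat_uniq /= y_v /= !andbF.
    lia.
  have lt_xy : x < y.
    rewrite ltn_neqAle le_xy andbT; apply: contraTneq uniq_w => eq_xy.
    rewrite cat_uniq; apply/negP => /and3P[_ /hasPn/(_ y) + _].
    by rewrite inE y_v orbT /= -eq_xy x_u => /(_ isT).
  exists x, (o + n), y; rewrite lt_xy lt_y; split=> //.
  rewrite -[[:: x; _; _]]cat1s cat_subseq ?sub1seq //.
  by rewrite /= eqxx sub1seq.
have eq_uv : perm_eq (sort leq v ++ sort leq u) (iota o n).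
  have: perm_eq ((u ++ v) ++ [:: o + n]) (iota o n ++ [:: o + n]).
    rewrite -[X in perm_eq _ X]/(iota o n ++ iota (o + n) 1) -iotaD addn1.
    rewrite -(permPr eq_w) -catA perm_cat2l perm_catC //.
  rewrite perm_cat2r; apply: perm_trans.
  by rewrite perm_catC perm_cat // ?perm_sort.
have srt : sort leq v ++ sort leq u = iota o n.
  apply: (sorted_eq leq_trans anti_leq) => //; last exact: iota_sorted.
  have leq_total : total leq by move=> x y; apply: leq_total.
  rewrite (sorted_pairwise leq_trans) pairwise_cat -!(sorted_pairwise leq_trans).
  rewrite !sort_sorted // !andbT; apply/allrelP => y x.
  by rewrite !mem_sort => y_v x_u; apply: ltnW; apply: gt_uv.
have size_n : size v + size u = n.
  by have := congr1 size srt; rewrite size_cat !size_sort size_iota.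
move/eqP: srt; rewrite -size_n iotaD eqseq_cat ?size_sort ?size_iota //.
case/andP=> /eqP srt_v /eqP srt_u.
have [|||t_u size_u word_u] := IHN (o + size v) (size u) u; first lia.
- by rewrite -srt_u perm_sym perm_sort.
- apply: contra_not no132; apply: has132_sub; exact: prefix_subseq.
have [|||t_v size_v word_v] := IHN o (size v) v; first lia.
- by rewrite -srt_v perm_sym perm_sort.
- apply: contra_not no132; apply: has132_sub.
  by apply: subseq_trans (suffix_subseq u _); apply: subseq_cons.
exists (Node t_u t_v) => /=; first by rewrite size_u size_v addnC.
by rewrite size_u size_v word_u word_v -addnA (addnC (size u)).
Qed.

(** * Increasing subsequences and block patterns in tree words *)

Lemma sorted_lt (u : seq nat) x y : sorted ltn (x :: u) -> y \in u -> x < y.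
Proof. by move=> /(order_path_min ltn_trans)/allP; apply. Qed.

(** A run that starts in L cannot continue in R, whose letters are smaller, and
    cannot go on after M: it is a run of L followed by at most M. *)
Lemma leq_lis o t u : subseq u (tree_word o t) -> sorted ltn u -> size u <= lis t.
Proof.
elim: t o u => [|l IHl r IHr] o u.
  by rewrite [tree_word _ _]/= subseq0 => /eqP->.
rewrite /=.
move=> /subseq_catP[u1 [u2 [-> sub1 sub2]]].
case: u1 sub1 => [|x u1] sub1 sorted_u.
  case: u2 => [//|y u2] in sub2 sorted_u *.
  move: sub2 => /=; case: eqP => [eq_y sub2|_ sub2]; last first.
    by rewrite leq_max (IHr o (y :: u2)) ?orbT.
  case: u2 => [|z u2] in sub2 sorted_u *; first by rewrite leq_max.
  have := sorted_lt sorted_u (mem_head z u2).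
  have := mem_subseq sub2 (mem_head z u2); rewrite mem_tree_word; lia.
have x_l := mem_subseq sub1 (mem_head x u1); rewrite mem_tree_word in x_l.
have sorted1 : sorted ltn (x :: u1).
  by apply: subseq_sorted sorted_u; [exact: ltn_trans|exact: prefix_subseq].
have le_l := IHl _ _ sub1 sorted1.
have mem2 y : y \in u2 -> x < y.
  by move=> y_u2; apply: (sorted_lt sorted_u); rewrite mem_cat y_u2 orbT.
case: u2 => [|y u2] in sub2 sorted_u mem2 *.
  by rewrite cats0 leq_max leqW.
move: sub2 => /=; case: eqP => [eq_y sub2|_ sub2]; last first.
  have := mem_subseq sub2 (mem_head y u2); rewrite mem_tree_word.
  have := mem2 y (mem_head _ _); lia.
case: u2 => [|z u2] in sub2 sorted_u mem2 *.
  by rewrite size_cat leq_max /= addn1 ltnS le_l.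
have := mem_subseq sub2 (mem_head z u2); rewrite mem_tree_word.
have := mem2 z; rewrite !inE eqxx orbT => /(_ isT); lia.
Qed.

Lemma exists_increasing o t k : k <= lis t ->
  exists u, [/\ subseq u (tree_word o t), sorted ltn u & size u = k].
Proof.
move=> le_k; suff [u [sub_u sorted_u size_u]] :
    exists u, [/\ subseq u (tree_word o t), sorted ltn u & size u = lis t].
  exists (take k u); split; last by rewrite size_takel ?size_u.
    exact: subseq_trans (take_subseq _ _) sub_u.
  exact: take_sorted.
elim: t o {k le_k} => [|l IHl r IHr] o /=; first by exists [::].
rewrite /maxn; case: ifP => _.
  have [u [sub_u sorted_u size_u]] := IHr o.
  exists u; split=> //; apply: subseq_trans sub_u _.
  by apply: subseq_trans (suffix_subseq (tree_word (o + nodes r) l) _); apply: subseq_cons.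
have [u [sub_u sorted_u size_u]] := IHl (o + nodes r).
exists (rcons u (o + nodes l + nodes r)); split.
- by rewrite -cats1 cat_subseq //= eqxx sub0seq.
- rewrite -cats1 (sorted_pairwise ltn_trans) pairwise_cat -!(sorted_pairwise ltn_trans).
  rewrite sorted_u /= !andbT; apply/allrelP => x y x_u; rewrite inE => /eqP->.
  have := mem_subseq sub_u x_u; rewrite mem_tree_word; lia.
- by rewrite size_rcons size_u.
Qed.

Definition two_blocks (p q : nat) (w : seq nat) : Prop :=
  exists u v, [/\ subseq (u ++ v) w, size u = p /\ size v = q,
    sorted ltn u /\ sorted ltn v & {in u & v, forall x y, y < x}].

Lemma sorted_nth_ltn (u : seq nat) i j : sorted ltn u -> i < size u -> j < size u ->
  (nth 0 u i < nth 0 u j) = (i < j).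
Proof.
move=> sorted_u lt_i lt_j; have u_lt := sorted_ltn_nth ltn_trans 0 sorted_u.
have [lt_ij|lt_ji|->] := ltngtP i j; last exact: ltnn.
  by rewrite u_lt.
by rewrite ltnNge ltnW // u_lt.
Qed.

Lemma occurs_block_patternP p q w :
  occurs (block_pattern (p + q) q) w <-> two_blocks p q w.
Proof.
rewrite /occurs /block_pattern addnK.
have size_pat : size (iota q.+1 p ++ iota 1 q) = p + q.
  by rewrite size_cat !size_iota.
have nth_pat i : i < p + q -> nth 0 (iota q.+1 p ++ iota 1 q) i =
    if i < p then q.+1 + i else (1 + (i - p)).
  move=> lt_i; rewrite nth_cat size_iota; case: ifP => lt_ip.
    by rewrite nth_iota.
  by rewrite nth_iota //; lia.
rewrite size_pat; split=> [[u [sub_u size_u u_iso]]|].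
  have size1 : size (take p u) = p by rewrite size_takel // size_u leq_addr.
  have size2 : size (drop p u) = q by rewrite size_drop size_u addKn.
  exists (take p u), (drop p u); rewrite cat_take_drop; split=> //.
    split; apply/(sortedP 0) => i; rewrite ?size1 ?size2 => lt_i /=.
      rewrite !nth_take ?u_iso ?nth_pat; try lia.
      by case: ifP; case: ifP; lia.
    rewrite !nth_drop u_iso ?nth_pat; try lia.
    by case: ifP; case: ifP; lia.
  move=> x y /(nthP 0)[i + <-] /(nthP 0)[j + <-]; rewrite size1 size2 => lt_i lt_j.
  rewrite nth_take // nth_drop u_iso ?nth_pat; try lia.
  by case: ifP; case: ifP; lia.
move=> [u [v [sub_uv [size_u size_v] [sorted_u sorted_v] gt_uv]]].
exists (u ++ v); split=> // [|i j lt_i lt_j]; first by rewrite size_cat size_u size_v.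
rewrite !nth_pat // !nth_cat size_u.
have nth_u k : k < p -> nth 0 u k \in u by move=> lt_k; rewrite mem_nth ?size_u.
have nth_v k : k < p + q -> ~~ (k < p) -> nth 0 v (k - p) \in v.
  by move=> lt_k ge_k; rewrite mem_nth // size_v; lia.
case: ifPn => [lt_ip|ge_ip]; case: ifPn => [lt_jp|ge_jp].
- by rewrite sorted_nth_ltn ?size_u //; lia.
- have := gt_uv _ _ (nth_u _ lt_ip) (nth_v _ lt_j ge_jp); lia.
- have := gt_uv _ _ (nth_u _ lt_jp) (nth_v _ lt_i ge_ip); lia.
- by rewrite sorted_nth_ltn ?size_v //; lia.
Qed.

(** Let u v be an occurrence in L M R, with u and v increasing and v below u. The
    maximum M is not in v, and if it is in u then it ends u. Without M, a run
    cannot have letters both in L and in R. So u v lies in L or in R, or else u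
    lies in L M and v in R. *)
Lemma two_blocks_tree_word p q o t : 0 < p -> 0 < q ->
  two_blocks p q (tree_word o t) <-> has_block p q t.
Proof.
move=> p_gt0 q_gt0; split.
  elim: t o => [|l IHl r IHr] o [u [v []]].
    by rewrite subseq0 => /eqP; case: u => [|? ?] // _ [/=]; lia.
  rewrite /=.
  move=> /subseq_catP[a [b [eq_ab sub_a sub_b]]] [size_u size_v].
  move=> [sorted_u sorted_v] gt_uv.
  set M := o + nodes l + nodes r in sub_b.
  have a_l x : x \in a -> o + nodes r <= x < M.
    move=> /(mem_subseq sub_a); rewrite mem_tree_word /M; lia.
  have b_r x : x \in b -> o <= x < o + nodes r \/ x = M.
    move=> /(mem_subseq sub_b); rewrite inE mem_tree_word /M.
    by case/orP=> [/eqP->|]; [right|left].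
  have v_lt y : y \in v -> y < M.
    case: (u) size_u eq_ab gt_uv => [|x u'] /= size_u eq_ab gt_uv y_v; first lia.
    have lt_yx : y < x by apply: gt_uv; rewrite ?mem_head.
    have : x \in a ++ b by rewrite -eq_ab mem_head.
    by rewrite mem_cat => /orP[/a_l|/b_r]; lia.
  have sub_r x c : subseq (x :: c) (M :: tree_word o r) -> x != M ->
      subseq (x :: c) (tree_word o r).
    by rewrite [subseq _ (_ :: _)]/= => + /negPf neM; rewrite neM.
  have v_r : subseq v (M :: tree_word o r) -> subseq v (tree_word o r).
    case: (v) v_lt => [|y v'] v_lt; first by rewrite !sub0seq.
    by move/sub_r; apply; rewrite neq_ltn v_lt ?mem_head.
  have Mcase c : sorted ltn (M :: c) -> subseq c (tree_word o r) -> c = [::].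
    case: c => // y c sorted_c /mem_subseq/(_ _ (mem_head _ _)).
    rewrite mem_tree_word => y_r.
    by have := sorted_lt sorted_c (mem_head _ _); rewrite /M; lia.
  have [[c [def_a def_v]]|[c [def_u def_b]]] := eq_catP eq_ab.
    case: c => [|z c] in def_a def_v *.
      rewrite cats0 in def_a; rewrite def_a in sub_a.
      rewrite /= in def_v; rewrite -def_v in sub_b.
      have := leq_lis sub_a sorted_u; have := leq_lis (v_r sub_b) sorted_v.
      by rewrite size_u size_v => -> /leqW->; rewrite !orbT.
    case: b => [|y b] in def_v b_r sub_b eq_ab *.
      rewrite cats0 in def_v; rewrite (IHl (o + nodes r)) //.
      by exists u, v; split=> //; rewrite def_v -def_a.
    have lt_zy : z < y.
      by rewrite def_v in sorted_v; apply: (sorted_lt sorted_v); rewrite mem_cat mem_head orbT.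
    have z_a : z \in a by rewrite def_a mem_cat mem_head orbT.
    have y_v : y \in v by rewrite def_v mem_cat mem_head orbT.
    have := a_l z z_a; have := v_lt y y_v; have := b_r y (mem_head _ _); lia.
  case: c => [|z c] in def_u def_b *.
    rewrite cats0 in def_u; rewrite -def_u in sub_a.
    rewrite /= in def_b; rewrite def_b in sub_b.
    have := leq_lis sub_a sorted_u; have := leq_lis (v_r sub_b) sorted_v.
    by rewrite size_u size_v => -> /leqW->; rewrite !orbT.
  rewrite def_b in sub_b.
  have sorted_zc : sorted ltn (z :: c).
    by move: sorted_u; rewrite def_u => /cat_sorted2[].
  have [eq_z|ne_z] := eqVneq z M.
    move: sub_b; rewrite /= eq_z eqxx => sub_cv; rewrite eq_z in sorted_zc.
    have sub_c := subseq_trans (prefix_subseq c v) sub_cv.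
    have sub_v := subseq_trans (suffix_subseq c v) sub_cv.
    move: def_u; rewrite (Mcase _ sorted_zc sub_c) => def_u.
    have sorted_a : sorted ltn a by move: sorted_u; rewrite def_u => /cat_sorted2[].
    have := leq_lis sub_a sorted_a; have := leq_lis sub_v sorted_v.
    move: size_u; rewrite def_u size_cat addn1 size_v => <- ->.
    by rewrite ltnS => ->; rewrite !orbT.
  have sub_rb := sub_r _ _ sub_b ne_z.
  case: a => [|x a] in def_u a_l sub_a eq_ab *.
    by rewrite (IHr o) ?orbT //; exists u, v; split=> //; rewrite def_u.
  have lt_xz : x < z.
    by move: sorted_u; rewrite def_u => /sorted_lt; apply; rewrite mem_cat mem_head orbT.
  have := a_l x (mem_head _ _).
  have := mem_subseq sub_rb (mem_head _ _); rewrite mem_tree_word; lia.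
have two_blocks_sub w1 w2 : subseq w1 w2 -> two_blocks p q w1 -> two_blocks p q w2.
  move=> sub12 [u [v [sub_uv ? ? ?]]]; exists u, v; split=> //.
  exact: subseq_trans sub_uv sub12.
elim: t o => [|l IHl r IHr] o //= /or3P[/IHl|/IHr|/andP[le_p le_q]].
- by move=> /(_ (o + nodes r)); apply: two_blocks_sub; apply: prefix_subseq.
- move=> /(_ o); apply: two_blocks_sub.
  by apply: subseq_trans (suffix_subseq (tree_word (o + nodes r) l) _); apply: subseq_cons.
have le_p' : p.-1 <= lis l by lia.
have [u [sub_u sorted_u size_u]] := exists_increasing (o + nodes r) le_p'.
have [v [sub_v sorted_v size_v]] := exists_increasing o le_q.
have u_l x : x \in u -> o + nodes r <= x < o + nodes l + nodes r.
  by move/(mem_subseq sub_u); rewrite mem_tree_word; lia.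
exists (rcons u (o + nodes l + nodes r)), v; split.
- by rewrite cat_rcons cat_subseq //= eqxx.
- by rewrite size_rcons size_u prednK.
- split=> //.
  rewrite -cats1 (sorted_pairwise ltn_trans) pairwise_cat -!(sorted_pairwise ltn_trans).
  rewrite sorted_u /= !andbT; apply/allrelP => x y /u_l x_u.
  by rewrite inE => /eqP->; lia.
- move=> x y; rewrite mem_rcons inE => x_u /(mem_subseq sub_v); rewrite mem_tree_word.
  by case/orP: x_u => [/eqP->|/u_l]; lia.
Qed.

(** * Enumerating trees *)

Fixpoint height (t : tree) : nat :=
  if t is Node l r then (maxn (height l) (height r)).+1 else 0.

(** Bounding the height rather than the size makes the recursion structural and
    the sum over [trees h.+1] a plain double sum over [trees h]. *)
Fixpoint trees (h : nat) : seq tree :=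
  if h is h'.+1
  then Leaf :: [seq Node l r | l <- trees h', r <- trees h']
  else [:: Leaf].

Lemma leq_height t : height t <= nodes t.
Proof. by elim: t => //= l IHl r IHr; lia. Qed.

Lemma mem_trees h t : (t \in trees h) = (height t <= h).
Proof.
elim: h t => [|h IHh] [|l r] //=; rewrite inE /= ltnS geq_max -!IHh.
apply/allpairsP/andP => [[[l' r'] /= [? ? [-> ->]]] //|[? ?]].
by exists (l, r).
Qed.

Lemma uniq_trees h : uniq (trees h).
Proof.
elim: h => //= h IHh; rewrite allpairs_uniq // ?andbT.
  by apply/negP => /allpairsP[[? ?] []].
by move=> [? ?] [? ?] _ _ [-> ->].
Qed.

Lemma sum_trees_size (R : nmodType) (g : tree -> R) n h : n <= h ->
  (\sum_(t <- trees h | nodes t == n) g t = \sum_(t <- trees n | nodes t == n) g t)%R.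
Proof.
move=> le_nh; rewrite -big_filter -[RHS]big_filter; apply: perm_big.
apply: uniq_perm; rewrite ?filter_uniq ?uniq_trees // => t.
rewrite !mem_filter !mem_trees; have := leq_height t.
by case: eqP => //= size_t; lia.
Qed.

(** Trees with n nodes and 132-avoiding permutations of size n are matched through
    their words, which determine both. *)
Lemma sum_avoids132 (R : nmodType) n (f : 'S_n -> R) (g : tree -> R) :
  (forall s t, nodes t = n -> word s = tree_word 0 t -> f s = g t) ->
  (\sum_(s : 'S_n | avoids pattern132 s) f s =
   \sum_(t <- trees n | nodes t == n) g t)%R.
Proof.
move=> eq_fg.
pose perm_of t : 'S_n := odflt 1%g [pick s : 'S_n | word s == tree_word 0 t].
have word_perm_of t : nodes t = n -> word (perm_of t) = tree_word 0 t.
  move=> size_t; rewrite /perm_of; case: pickP => [s /eqP//|no_s].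
  have /exists_word[s [word_s _]] : perm_eq (tree_word 0 t) (iota 0 n).
    by rewrite -size_t; apply: perm_tree_word.
  by have := no_s s; rewrite word_s eqxx.
transitivity (\sum_(t <- trees n | nodes t == n) f (perm_of t))%R; last first.
  by apply: eq_bigr => t /eqP size_t; apply: eq_fg; rewrite ?word_perm_of.
rewrite -[LHS]big_filter -[RHS]big_filter -(big_map perm_of xpredT f).
apply: perm_big; apply: uniq_perm.
- by rewrite filter_uniq ?index_enum_uniq.
- rewrite map_inj_in_uniq ?filter_uniq ?uniq_trees // => t u.
  rewrite !mem_filter => /andP[/eqP size_t _] /andP[/eqP size_u _] eq_tu.
  by apply: (@tree_word_inj 0); rewrite -!word_perm_of // eq_tu.
move=> s; rewrite mem_filter mem_index_enum andbT.
apply/idP/mapP => [/containsP no132|[t + ->]].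
  have [|t size_t word_t] := tree_word_surj (perm_word s).
    by move/occurs132P.
  exists t; last by apply: word_inj; rewrite word_perm_of.
  by rewrite mem_filter size_t eqxx mem_trees (leq_trans (leq_height t)) ?size_t.
rewrite mem_filter => /andP[/eqP size_t _].
apply/containsP => /occurs132P; rewrite word_perm_of //; exact: tree_word_avoids132.
Qed.

Local Open Scope ring_scope.
Import GRing.Theory.

Lemma M_coef_trees p q n h : (0 < p)%N -> (0 < q)%N -> (n <= h)%N ->
  M_coef (block_pattern (p + q) q) n =
  \sum_(t <- trees h | nodes t == n) (~~ has_block p q t)%:R * (-1) ^+ tree_odd t.
Proof.
move=> p_gt0 q_gt0 le_nh; rewrite sum_trees_size //.
set tau := block_pattern _ _.
transitivity (\sum_(s : 'S_n | avoids pattern132 s)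
                (avoids tau s)%:R * (-1) ^+ odd_perm s : rat).
  rewrite /M_coef /even_count /odd_count -!sum1_card !natr_sum.
  rewrite !(big_mkcond (fun s => s \in _)) -sumrB [RHS]big_mkcond.
  apply: eq_bigr => s _; rewrite !inE.
  by case: odd_perm; case: (avoids pattern132); case: (avoids tau);
    rewrite /= ?expr0 ?expr1 ?mulr1 ?mul0r ?mul1r ?subr0 ?sub0r.
apply: sum_avoids132 => s t size_t word_s.
rewrite odd_word word_s odd_inversions_tree_word; congr ((~~ _)%:R * _).
apply/containsP/idP => [/occurs_block_patternP|has_t].
  by rewrite word_s => /two_blocks_tree_word; apply.
by apply/occurs_block_patternP; rewrite word_s; apply/two_blocks_tree_word.
Qed.

(** * Signed generating polynomials *)

(** Only one parity of the size is kept, b = true standing for odd, because the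
    sign of L M R depends on the parities of |L| and |R|. *)
Definition signed_gf (b : bool) (w : tree -> rat) (h : nat) : {poly rat} :=
  \sum_(t <- trees h | odd (nodes t) == b) (w t * (-1) ^+ tree_odd t) *: 'X^(nodes t).

Definition leaf_weight (t : tree) : rat := (t == Leaf)%:R.

Definition node_weight (u v : tree -> rat) (t : tree) : rat :=
  if t is Node l r then u l * v r else 0.

Lemma signed_gf_leaf b h : signed_gf b leaf_weight h = (~~ b)%:R.
Proof.
have Leaf_h : Leaf \in trees h by rewrite mem_trees.
rewrite /signed_gf big_mkcond (bigD1_seq Leaf) ?uniq_trees //= big1 => [|t ne_t].
  by case: b => /=; rewrite ?addr0 // mulr1 scale1r.
by rewrite /leaf_weight (negPf ne_t) mul0r scale0r if_same.
Qed.

Lemma signed_gfD b u v h :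
  signed_gf b (fun t => u t + v t) h = signed_gf b u h + signed_gf b v h.
Proof. by rewrite -big_split; apply: eq_bigr => t _; rewrite mulrDl scalerDl. Qed.

Lemma signed_gfB b u v h :
  signed_gf b (fun t => u t - v t) h = signed_gf b u h - signed_gf b v h.
Proof. by rewrite -sumrB; apply: eq_bigr => t _; rewrite mulrBl scalerBl. Qed.

Lemma eq_signed_gf b u v h : u =1 v -> signed_gf b u h = signed_gf b v h.
Proof. by move=> eq_uv; apply: eq_bigr => t _; rewrite eq_uv. Qed.

(** Of the four combinations of size parities, only an even left and an odd right
    subtree reverse the sign; the parity of the new size is that of
    |L| + |R| + 1. *)
Lemma signed_gf_node b u v h : signed_gf b (node_weight u v) h.+1 =
  'X * (if b
        then signed_gf false u h * signed_gf false v h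
             + signed_gf true u h * signed_gf true v h
        else signed_gf true u h * signed_gf false v h
             - signed_gf false u h * signed_gf true v h).
Proof.
rewrite /signed_gf big_mkcond big_cons /= mul0r scale0r if_same add0r big_allpairs_dep.
rewrite ![in RHS](big_mkcond (fun t => odd (nodes t) == _)) /=.
case: b; rewrite !big_distrlr -?sumrB -?big_split mulr_sumr;
  apply: eq_bigr => l _; rewrite -?sumrB -?big_split mulr_sumr;
  apply: eq_bigr => r _; rewrite /= oddD !signr_addb exprS exprD;
  case: (odd (nodes l)); case: (odd (nodes r)) => /=;
  rewrite -?mul_polyC ?polyCM ?expr0 ?expr1 ?polyCN ?polyC1; ring.
Qed.

(** Equality of power series up to order N. *)
Definition congX (N : nat) (a b : {poly rat}) : bool := 'X^N %| a - b.

(** A tree of height h + 1 has at least h + 1 nodes. This turns the passage from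
    h to h + 1 in [signed_gf_node] into an equation between power series. *)
Lemma signed_gf_stable b w h : congX h.+1 (signed_gf b w h.+1) (signed_gf b w h).
Proof.
have -> : signed_gf b w h = \sum_(t <- trees h.+1 | (odd (nodes t) == b) && (height t <= h)%N)
                      (w t * (-1) ^+ tree_odd t) *: 'X^(nodes t).
  rewrite /signed_gf -big_filter -[RHS]big_filter; apply: perm_big.
  apply: uniq_perm; rewrite ?filter_uniq ?uniq_trees // => t.
  by rewrite !mem_filter !mem_trees; case: eqP => //= _; lia.
rewrite /congX /signed_gf (bigID (fun t => (height t <= h)%N)) /= addrAC subrr add0r.
elim/big_ind: _ => [|p q|t /andP[_ gt_t]]; first exact: dvdp0.
  exact: dvdp_add.
rewrite -mul_polyC dvdp_mull // dvdp_exp2l //.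
by have := leq_height t; lia.
Qed.

Lemma coef_signed_gf w n h : (n <= h)%N ->
  (signed_gf false w h + signed_gf true w h)`_n =
  \sum_(t <- trees h | nodes t == n) w t * (-1) ^+ tree_odd t.
Proof.
move=> le_nh.
have -> : signed_gf false w h + signed_gf true w h =
    \sum_(t <- trees h) (w t * (-1) ^+ tree_odd t) *: 'X^(nodes t).
  rewrite (bigID (fun t => odd (nodes t))) addrC /=.
  by congr (_ + _); apply: eq_bigl => t; case: odd.
rewrite coef_sum [RHS]big_mkcond; apply: eq_bigr => t _.
by rewrite coefZ coefXn eq_sym; case: eqP; rewrite ?mulr1 ?mulr0.
Qed.

(** * Tree weights *)

Definition lis_lt (k : nat) (t : tree) : rat := (lis t < k)%N%:R.

Lemma lis_ltS k t :
  lis_lt k.+1 t = leaf_weight t + node_weight (lis_lt k) (lis_lt k.+1) t.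
Proof.
case: t => [|l r]; rewrite /lis_lt /leaf_weight /= ?addr0 //.
by rewrite gtn_max ltnS add0r -natrM mulnb.
Qed.

Definition avoid_weight (p q : nat) (t : tree) : rat := (~~ has_block p q t)%:R.

Lemma has_block_lis p q t : has_block p q t -> (p <= lis t)%N && (q <= lis t)%N.
Proof. by elim: t => //= l IHl r IHr /or3P[/IHl|/IHr|]; lia. Qed.

(** Inclusion and exclusion on the two ways to avoid a straddling occurrence. A
    tree with too short increasing runs avoids the pattern, which is why the
    avoidance factor is absorbed by [lis_lt]. *)
Lemma avoid_weightE p q t :
  avoid_weight p.+1 q t = leaf_weight t
    + node_weight (lis_lt p) (avoid_weight p.+1 q) t
    + node_weight (avoid_weight p.+1 q) (lis_lt q) t
    - node_weight (lis_lt p) (lis_lt q) t.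
Proof.
case: t => [|l r]; rewrite /lis_lt /avoid_weight /leaf_weight /=.
  by rewrite subr0 !addr0.
rewrite !negb_or negb_and -!ltnNge ltnS.
have [lt_p|ge_p] := ltnP (lis l) p; have [lt_q|ge_q] := ltnP (lis r) q;
  rewrite ?andbF ?andbT ?add0r ?mul1r ?mul0r ?mulr0 ?mulr1 ?subr0 ?addr0 ?addrK //=.
- have /negPf-> : ~~ has_block p.+1 q l.
    by apply/negP => /has_block_lis; lia.
  have /negPf-> : ~~ has_block p.+1 q r by apply/negP => /has_block_lis; lia.
  by [].
- have /negPf-> : ~~ has_block p.+1 q l.
    by apply/negP => /has_block_lis; lia.
  by [].
- have /negPf-> : ~~ has_block p.+1 q r by apply/negP => /has_block_lis; lia.
  by rewrite add0r andbT.
Qed.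

(** * Solving the recurrences modulo powers of X *)

(** A polynomial with nonzero constant term is invertible modulo X^N. *)
Lemma congX_cancel N (c a b : {poly rat}) :
  c`_0 != 0 -> congX N (c * a) (c * b) -> congX N a b.
Proof.
move=> c0; rewrite /congX -mulrBr Gauss_dvdpr //.
rewrite coprimep_sym coprimep_expr // coprimepX /root.
by rewrite horner_coef0.
Qed.

(** Numerator and denominator of R_k(x^2), obtained from the recurrence
    R_(k+1)(x^2) = 1 / (1 - x^2 R_k(x^2)). *)
Fixpoint Rfrac (k : nat) : {poly rat} * {poly rat} :=
  if k is k'.+1 then ((Rfrac k').2, (Rfrac k').2 - 'X ^+ 2 * (Rfrac k').1)
  else (0, 1).
Definition Rnum k := (Rfrac k).1.
Definition Rden k := (Rfrac k).2.

Lemma RnumS k : Rnum k.+1 = Rden k. Proof. by []. Qed.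

Lemma RdenS k : Rden k.+1 = Rden k - 'X ^+ 2 * Rnum k. Proof. by []. Qed.

Lemma horner0_Rden k : (Rden k).[0] = 1.
Proof.
elim: k => [|k IHk]; first by rewrite /Rden /= hornerE.
by rewrite RdenS !hornerE IHk.
Qed.

(** One step of F = 1 / (1 - i x conj(F')), written with even and odd parts and
    without denominators: for R = q / p it leads from R / (1 - i x R) to
    1 + i x R. *)
Lemma lis_step_to_odd N (Fe Fo Fe' Fo' p q : {poly rat})
    (s := p ^+ 2 + 'X ^+ 2 * q ^+ 2) : p.[0] = 1 ->
  congX N Fe (1 + 'X * (Fo' * Fe - Fe' * Fo)) ->
  congX N Fo ('X * (Fe' * Fe + Fo' * Fo)) ->
  congX N (s * Fe') (q * p) -> congX N (s * Fo') ('X * q ^+ 2) ->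
  congX N Fe 1 /\ congX N (p * Fo) ('X * q).
Proof.
move=> p0 rec_e rec_o hyp_e hyp_o.
have s0 : s`_0 != 0 by rewrite -horner_coef0 /s !hornerE p0 expr1n ?mul0r ?addr0 oner_eq0.
have p0' : p`_0 != 0 by rewrite -horner_coef0 p0 oner_eq0.
have pFo : congX N (p * Fo) ('X * q * Fe).
  apply: (congX_cancel p0'); rewrite /congX.
  rewrite (_ : _ - _ = s * (Fo - 'X * (Fe' * Fe + Fo' * Fo))
    + 'X * Fe * (s * Fe' - q * p) + 'X * Fo * (s * Fo' - 'X * q ^+ 2)).
    by rewrite !dvdp_add ?dvdp_mull.
  by rewrite /s; ring.
have Fe1 : congX N Fe 1.
  apply: (congX_cancel s0); rewrite /congX.
  rewrite (_ : _ - _ = s * (Fe - (1 + 'X * (Fo' * Fe - Fe' * Fo)))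
    + 'X * Fe * (s * Fo' - 'X * q ^+ 2) + (- 'X * Fo) * (s * Fe' - q * p)
    + (- 'X * q) * (p * Fo - 'X * q * Fe)).
    by rewrite !dvdp_add ?dvdp_mull.
  by rewrite /s; ring.
split=> //; rewrite /congX.
rewrite (_ : _ - _ = (p * Fo - 'X * q * Fe) + 'X * q * (Fe - 1)); last by ring.
by rewrite dvdp_add ?dvdp_mull.
Qed.

(** The same recurrence leads from 1 + i x R to R' / (1 - i x R'), where
    R' = 1 / (1 - x^2 R) = p / p'. *)
Lemma lis_step_to_even N (Fe Fo Fe' Fo' p q : {poly rat}) (p' := p - 'X ^+ 2 * q) :
  congX N Fe (1 + 'X * (Fo' * Fe - Fe' * Fo)) ->
  congX N Fo ('X * (Fe' * Fe + Fo' * Fo)) ->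
  congX N Fe' 1 -> congX N (p * Fo') ('X * q) ->
  congX N ((p' ^+ 2 + 'X ^+ 2 * p ^+ 2) * Fe) (p * p') /\
  congX N ((p' ^+ 2 + 'X ^+ 2 * p ^+ 2) * Fo) ('X * p ^+ 2).
Proof.
move=> rec_e rec_o hyp_e hyp_o.
have eq1 : congX N (p' * Fe + 'X * p * Fo) p.
  rewrite /congX (_ : _ - _ = p * (Fe - (1 + 'X * (Fo' * Fe - Fe' * Fo)))
    + 'X * Fe * (p * Fo' - 'X * q) + (- 'X * p * Fo) * (Fe' - 1)).
    by rewrite !dvdp_add ?dvdp_mull.
  by rewrite /p'; ring.
have eq2 : congX N (p' * Fo) ('X * p * Fe).
  rewrite /congX (_ : _ - _ = p * (Fo - 'X * (Fe' * Fe + Fo' * Fo))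
    + 'X * p * Fe * (Fe' - 1) + 'X * Fo * (p * Fo' - 'X * q)).
    by rewrite !dvdp_add ?dvdp_mull.
  by rewrite /p'; ring.
split; rewrite /congX.
  rewrite (_ : _ - _ = p' * (p' * Fe + 'X * p * Fo - p)
    + (- 'X * p) * (p' * Fo - 'X * p * Fe)); last by ring.
  by rewrite !dvdp_add ?dvdp_mull.
rewrite (_ : _ - _ = p' * (p' * Fo - 'X * p * Fe)
  + 'X * p * (p' * Fe + 'X * p * Fo - p)); last by ring.
by rewrite !dvdp_add ?dvdp_mull.
Qed.

Lemma signed_gf_lis_rec_even k h : congX h.+1 (signed_gf false (lis_lt k.+1) h)
  (1 + 'X * (signed_gf true (lis_lt k) h * signed_gf false (lis_lt k.+1) h
             - signed_gf false (lis_lt k) h * signed_gf true (lis_lt k.+1) h)).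
Proof.
have := signed_gf_stable false (lis_lt k.+1) h.
rewrite (eq_signed_gf _ _ (lis_ltS k)) signed_gfD signed_gf_leaf signed_gf_node.
by rewrite /= /congX -dvdpNr opprB.
Qed.

Lemma signed_gf_lis_rec_odd k h : congX h.+1 (signed_gf true (lis_lt k.+1) h)
  ('X * (signed_gf false (lis_lt k) h * signed_gf false (lis_lt k.+1) h
             + signed_gf true (lis_lt k) h * signed_gf true (lis_lt k.+1) h)).
Proof.
have := signed_gf_stable true (lis_lt k.+1) h.
rewrite (eq_signed_gf _ _ (lis_ltS k)) signed_gfD signed_gf_leaf signed_gf_node.
by rewrite /= add0r /congX -dvdpNr opprB.
Qed.

Lemma signed_gf_lis_even k h (s := Rden k ^+ 2 + 'X ^+ 2 * Rnum k ^+ 2) :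
  congX h.+1 (s * signed_gf false (lis_lt k.*2) h) (Rnum k * Rden k) /\
  congX h.+1 (s * signed_gf true (lis_lt k.*2) h) ('X * Rnum k ^+ 2).
Proof.
rewrite /s; elim: k {s} => [|k [IHe IHo]].
  have signed_gf0 b : signed_gf b (lis_lt 0) h = 0.
    by rewrite /signed_gf big1 // => t _; rewrite mul0r scale0r.
  by rewrite !signed_gf0 /= !mulr0 mul0r expr0n mulr0 /congX subrr dvdp0.
have [odd_e odd_o] := lis_step_to_odd (horner0_Rden k)
  (signed_gf_lis_rec_even _ _) (signed_gf_lis_rec_odd _ _) IHe IHo.
rewrite RdenS RnumS doubleS.
exact: (lis_step_to_even (signed_gf_lis_rec_even _ _) (signed_gf_lis_rec_odd _ _)
          odd_e odd_o).
Qed.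

Lemma signed_gf_lis_odd k h :
  congX h.+1 (signed_gf false (lis_lt k.*2.+1) h) 1 /\
  congX h.+1 (Rden k * signed_gf true (lis_lt k.*2.+1) h) ('X * Rnum k).
Proof.
have [even_e even_o] := signed_gf_lis_even k h.
exact: (lis_step_to_odd (horner0_Rden k) (signed_gf_lis_rec_even _ _)
          (signed_gf_lis_rec_odd _ _) even_e even_o).
Qed.

(** Numerator and denominator of the announced fraction, both multiplied by
    (P_m P_d)^2. *)
Definition avoid_num (m d : nat) : {poly rat} :=
  let Q := Rnum m in let P := Rden m in let q := Rnum d in let p := Rden d in
  (P * p - 'X ^+ 2 * (Q * p + q * P) + 'X * (P * p - 'X ^+ 2 * Q * q))
  * (P * p + 'X ^+ 2 * Q * q).

Definition avoid_den (m d : nat) : {poly rat} :=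
  let Q := Rnum m in let P := Rden m in let q := Rnum d in let p := Rden d in
  P ^+ 2 * p ^+ 2
  - 'X ^+ 2 * (P ^+ 2 + 'X ^+ 2 * Q ^+ 2) * (p ^+ 2 + 'X ^+ 2 * q ^+ 2).

(** Multiplying the two equations by s p and replacing F and G by their values
    gives a linear system in Me and Mo whose determinant is s times the
    denominator below. *)
Lemma solve_avoid N (Fe Fo Ge Go Me Mo P Q p q : {poly rat})
    (s := P ^+ 2 + 'X ^+ 2 * Q ^+ 2) : P.[0] = 1 ->
  congX N (s * Fe) (Q * P) -> congX N (s * Fo) ('X * Q ^+ 2) ->
  congX N Ge 1 -> congX N (p * Go) ('X * q) ->
  congX N Me (1 + 'X * ((Fo * Me - Fe * Mo) + (Mo * Ge - Me * Go)
                        - (Fo * Ge - Fe * Go))) ->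
  congX N Mo ('X * ((Fe * Me + Fo * Mo) + (Me * Ge + Mo * Go)
                        - (Fe * Ge + Fo * Go))) ->
  congX N ((P ^+ 2 * p ^+ 2 - 'X ^+ 2 * s * (p ^+ 2 + 'X ^+ 2 * q ^+ 2)) * (Me + Mo))
   ((P * p - 'X ^+ 2 * (Q * p + q * P) + 'X * (P * p - 'X ^+ 2 * Q * q))
    * (P * p + 'X ^+ 2 * Q * q)).
Proof.
move=> P0 hFe hFo hGe hGo hMe hMo.
have s0 : s`_0 != 0 by rewrite -horner_coef0 /s !hornerE P0 expr1n ?mul0r ?addr0 oner_eq0.
have eq1 : congX N ((P ^+ 2 * p + 'X ^+ 2 * q * s) * Me + 'X * p * (Q * P - s) * Mo)
    (P ^+ 2 * p + 'X ^+ 2 * Q * P * q).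
  rewrite /congX (_ : _ - _ =
    s * p * (Me - (1 + 'X * ((Fo * Me - Fe * Mo) + (Mo * Ge - Me * Go) - (Fo * Ge - Fe * Go))))
    + 'X * (s * p * Mo - p * 'X * Q ^+ 2) * (Ge - 1)
    + 'X * (Q * P - s * Me) * (p * Go - 'X * q)
    + 'X * (p * Me - p * Ge) * (s * Fo - 'X * Q ^+ 2)
    + 'X * (p * Go - p * Mo) * (s * Fe - Q * P)).
    by rewrite !dvdp_add ?dvdp_mull.
  by rewrite /s; ring.
have eq2 : congX N ((P ^+ 2 * p - 'X ^+ 2 * q * s) * Mo - 'X * p * (s + Q * P) * Me)
    (- 'X * (Q * P * p + 'X ^+ 2 * Q ^+ 2 * q)).
  rewrite /congX (_ : _ - _ =
    s * p * (Mo - 'X * ((Fe * Me + Fo * Mo) + (Me * Ge + Mo * Go) - (Fe * Ge + Fo * Go)))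
    + 'X * (s * p * Me - p * (Q * P)) * (Ge - 1)
    + 'X * (s * Mo - 'X * Q ^+ 2) * (p * Go - 'X * q)
    + 'X * (p * Mo - p * Go) * (s * Fo - 'X * Q ^+ 2)
    + 'X * (p * Me - p * Ge) * (s * Fe - Q * P)).
    by rewrite !dvdp_add ?dvdp_mull.
  by rewrite /s; ring.
(* Cramer's rule: the factors are differences of the coefficients of eq1, eq2. *)
apply: (congX_cancel s0); rewrite /congX.
rewrite (_ : _ - _ =
  (P ^+ 2 * p - 'X ^+ 2 * q * s + 'X * p * (s + Q * P))
  * ((P ^+ 2 * p + 'X ^+ 2 * q * s) * Me + 'X * p * (Q * P - s) * Mo
     - (P ^+ 2 * p + 'X ^+ 2 * Q * P * q))
  + (P ^+ 2 * p + 'X ^+ 2 * q * s - 'X * p * (Q * P - s))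
  * ((P ^+ 2 * p - 'X ^+ 2 * q * s) * Mo - 'X * p * (s + Q * P) * Me
     - (- 'X * (Q * P * p + 'X ^+ 2 * Q ^+ 2 * q)))).
  by rewrite dvdp_add ?dvdp_mull.
by rewrite /s; ring.
Qed.

Lemma congX_coef N n a b : (n < N)%N -> congX N a b -> a`_n = b`_n.
Proof.
move=> lt_nN /dvdpP[c def_c]; apply/eqP; rewrite -subr_eq0 -coefB def_c.
by rewrite coefMXn lt_nN.
Qed.

Lemma coef0_avoid_den m d : (avoid_den m d)`_0 = 1.
Proof.
rewrite -horner_coef0 /avoid_den !hornerE !horner0_Rden.
by rewrite ?expr0n ?expr1n ?mul0r ?mulr1 ?subr0.
Qed.

Lemma avoid_series m d n :
  \sum_(i < n.+1) (avoid_den m d)`_i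
     * M_coef (block_pattern (m.*2.+1 + d.*2.+1) d.*2.+1) (n - i)%N
  = (avoid_num m d)`_n.
Proof.
set w := avoid_weight m.*2.+1 d.*2.+1.
pose Me := signed_gf false w n; pose Mo := signed_gf true w n.
have den_M : congX n.+1 (avoid_den m d * (Me + Mo)) (avoid_num m d).
  have [hFe hFo] := signed_gf_lis_even m n; have [hGe hGo] := signed_gf_lis_odd d n.
  apply: (solve_avoid (horner0_Rden m) hFe hFo hGe hGo).
    have := signed_gf_stable false w n; rewrite (eq_signed_gf _ _ (avoid_weightE _ _)).
    rewrite signed_gfB !signed_gfD signed_gf_leaf !signed_gf_node /congX -dvdpNr => dvd_w.
    by apply: etrans dvd_w; congr (_ %| _); rewrite /Me /Mo /w /=; ring.
  have := signed_gf_stable true w n; rewrite (eq_signed_gf _ _ (avoid_weightE _ _)).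
  rewrite signed_gfB !signed_gfD signed_gf_leaf !signed_gf_node /congX -dvdpNr => dvd_w.
  by apply: etrans dvd_w; congr (_ %| _); rewrite /Me /Mo /w /=; ring.
rewrite -(congX_coef (ltnSn n) den_M) coefM; apply: eq_bigr => i _.
by rewrite coef_signed_gf ?leq_subr // -M_coef_trees ?leq_subr.
Qed.

Local Notation F := {fraction {poly rat}}.

Lemma tofrac_neq0 (p : {poly rat}) : p.[0] = 1 -> p%:F != 0.
Proof.
move=> p0; rewrite tofrac_eq0; apply: contra_eq_neq p0 => ->.
by rewrite horner0 eq_sym oner_eq0.
Qed.

(** U_k(1 / (2 x)) = p_k / x^k, because p_(k+1) = p_k - x^2 p_(k-1) is the
    Chebyshev recurrence rescaled by x^(k+1). *)
Lemma R_sq_quotient (K : fieldType) (x : K) (q p : nat -> K) k :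
  x != 0 -> 2%:R != 0 :> K -> q 0%N = 0 -> p 0%N = 1 ->
  (forall j, q j.+1 = p j) -> (forall j, p j.+1 = p j - x ^+ 2 * q j) ->
  (forall j, p j != 0) -> R_sq k x = q k / p k.
Proof.
move=> x_neq0 two_neq0 q0 p0 qS pS p_neq0.
have chebU_p j : (chebU K j).[(2%:R * x)^-1] = p j / x ^+ j.
  suff [] : (chebU K j).[(2%:R * x)^-1] = p j / x ^+ j /\
    (chebU K j.+1).[(2%:R * x)^-1] = p j.+1 / x ^+ j.+1 by [].
  elim: j => [|j [IH1 IH2]].
    rewrite pS q0 p0 /= !hornerE.
    by split; field; rewrite ?oner_neq0 ?x_neq0 ?two_neq0.
  split=> //.
  rewrite [chebU _ _]/= -/(chebU K j.+1) !hornerE IH2 IH1 (pS j.+1) qS.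
  have := expf_neq0 j x_neq0; rewrite !exprS; move: (x ^+ j) => y y_neq0.
  by field; rewrite x_neq0 y_neq0 two_neq0.
case: k => [|k]; first by rewrite q0 mul0r.
rewrite /R_sq !chebU_p qS exprS.
have := expf_neq0 k x_neq0; move: (x ^+ k) => y y_neq0.
by field; rewrite x_neq0 y_neq0 p_neq0.
Qed.

Lemma R_sqE k : R_sq k ('X%:F : F) = (Rnum k)%:F / (Rden k)%:F.
Proof.
apply: (R_sq_quotient (q := fun j => (Rnum j)%:F) (p := fun j => (Rden j)%:F)).
- by rewrite tofrac_eq0 polyX_eq0.
- by rewrite -(rmorph_nat (@tofrac _)) tofrac_eq0 -polyC_natr polyC_eq0.
- exact: tofrac0.
- exact: tofrac1.
- by [].
- by move=> j; rewrite RdenS tofracB tofracM tofracXn.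
- by move=> j; apply: tofrac_neq0; apply: horner0_Rden.
Qed.

Lemma clear_denominators (K : fieldType) (x P Q p q : K)
    (num := (P * p - x ^+ 2 * (Q * p + q * P) + x * (P * p - x ^+ 2 * Q * q))
            * (P * p + x ^+ 2 * Q * q))
    (den := P ^+ 2 * p ^+ 2
            - x ^+ 2 * (P ^+ 2 + x ^+ 2 * Q ^+ 2) * (p ^+ 2 + x ^+ 2 * q ^+ 2)) :
  P != 0 -> p != 0 -> den != 0 ->
  (1 - x ^+ 2 * (Q / P + q / p) + x * (1 - x ^+ 2 * (Q / P) * (q / p)))
     * (1 + x ^+ 2 * (Q / P) * (q / p))
   / (1 - x ^+ 2 * (1 + x ^+ 2 * (Q / P) ^+ 2) * (1 + x ^+ 2 * (q / p) ^+ 2))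
  = num / den.
Proof.
move=> P_neq0 p_neq0 den_neq0.
have -> : 1 - x ^+ 2 * (1 + x ^+ 2 * (Q / P) ^+ 2) * (1 + x ^+ 2 * (q / p) ^+ 2)
    = den / (P * p) ^+ 2.
  by rewrite /den; field; rewrite P_neq0 p_neq0.
rewrite -[den]/den; move: (den) den_neq0 => D D_neq0.
by rewrite /num; field; rewrite P_neq0 p_neq0 D_neq0.
Qed.

Theorem theorem2p21 (k d : nat) (hdk : (d < k)%N) :
  let m := (k - d - 1)%N in
  let x : {fraction {poly rat}} := ('X : {poly rat})%:F in
  let Rm := R_sq m x in
  let Rd := R_sq d x in
  is_expansion (M_coef (block_pattern (2 * k) (2 * d + 1)))
    ((1 - x ^+ 2 * (Rm + Rd) + x * (1 - x ^+ 2 * Rm * Rd))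
       * (1 + x ^+ 2 * Rm * Rd)
     / (1 - x ^+ 2 * (1 + x ^+ 2 * Rm ^+ 2) * (1 + x ^+ 2 * Rd ^+ 2))).
Proof.
move=> m x Rm Rd; exists (avoid_num m d), (avoid_den m d); split.
- by rewrite coef0_avoid_den.
- have den_neq0 : (avoid_den m d)%:F != 0.
    by apply: tofrac_neq0; rewrite horner_coef0 coef0_avoid_den.
  have Pm_neq0 := tofrac_neq0 (horner0_Rden m).
  have Pd_neq0 := tofrac_neq0 (horner0_Rden d).
  rewrite /Rm /Rd !R_sqE; move: den_neq0.
  rewrite /avoid_num /avoid_den !(tofracB, tofracD, tofracM, tofracXn) => den_neq0.
  by rewrite (clear_denominators Pm_neq0 Pd_neq0 den_neq0).
- move=> n; rewrite -avoid_series.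
  have -> : (2 * d + 1 = d.*2.+1)%N by lia.
  by have -> : (2 * k = m.*2.+1 + d.*2.+1)%N by rewrite /m; lia.
Qed.
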